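(* Let $\mathcal{D}$ be a subalgebra of a Banach algebra $\mathcal{A}$, let $\sigma,d:\mathcal{D}\to\mathcal{A}$ be linear mappings, and let $d$ be a $\sigma$-derivation. Then for every natural number $n$ and all $a,b\in\mathcal{D}$, $$d^n(ab)=\sum_{k=0}^{2^n-1}\varphi_{n,k}(a)\,\varphi_{n,2^n-1-k}(b).$$
   Context: $d$ is a $\sigma$-derivation if $d(ab)=d(a)\sigma(b)+\sigma(a)d(b)$ for all $a,b\in\mathcal{D}$; $\sigma$ is only assumed linear. For a natural number $n$ and $0\le k\le 2^n-1$, the mapping $\varphi_{n,k}$ is obtained by writing $k$ in base $2$ with exactly $n$ digits (including leading zeros), $k=(c_n\ldots c_1)_2$, and putting $d$ for each digit $1$ and $\sigma$ for each digit $0$; that is, $\varphi_{n,k}$ is the composition $\delta_n\delta_{n-1}\cdots\delta_1$ (with $\delta_1$ applied first), where $\delta_i=d$ if $c_i=1$ and $\delta_i=\sigma$ if $c_i=0$. For example, $\varphi_{5,11}=\sigma d\sigma d d=\sigma d\sigma d^2$ since $11=(01011)_2$. Juxtaposition and powers of mappings denote composition.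
   Formalization: Since σ and d map D into A, not D, the compositions d^n and φ_{n,k} may be undefined for n ≥ 2; the identity is proved for all a, b in D at which every φ_{n,k}(a), φ_{n,k}(b) with 0 ≤ k ≤ 2^n−1 is defined (all a, b if σ and d map D into D), and d^n(ab) is then shown to be defined. *)

(* Defs.v *)
From HB Require Import structures.
From mathcomp Require Import all_boot all_order all_algebra.
From mathcomp Require Import all_classical all_reals all_analysis.

Set Implicit Arguments.
Unset Strict Implicit.
Unset Printing Implicit Defensive.

Import GRing.Theory numFieldNormedType.Exports.
Local Open Scope ring_scope.

(* Not necessarily unital, so the ring structures of MathComp do not apply.
   The scalars are those allowed by completeNormedModType; K := R and
   K := R[i] (for R : realType) give real and complex Banach algebras. *)
HB.mixin Record CompleteNormedModule_isBanachAlgebra (K : numFieldType) A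
    of CompleteNormedModule K A := {
  bmul : A -> A -> A ;
  bmulA : associative bmul ;
  bmulDl : left_distributive bmul +%R ;
  bmulDr : right_distributive bmul +%R ;
  bmulZl : forall (c : K) (x y : A), bmul (c *: x) y = c *: bmul x y ;
  bmulZr : forall (c : K) (x y : A), bmul x (c *: y) = c *: bmul x y ;
  bnormM : forall x y : A, `|bmul x y| <= `|x| * `|y|
}.

#[short(type="banachAlgType")]
HB.structure Definition BanachAlgebra (K : numFieldType) :=
  {A of CompleteNormedModule_isBanachAlgebra K A & CompleteNormedModule K A}.

(* A subalgebra need not be closed for the norm topology. *)
Record subalgebra (K : numFieldType) (A : banachAlgType K) := Subalgebra {
  subalg_pred :> {pred A} ;
  subalg_submod : submod_closed subalg_pred ;
  subalg_mulr : {in subalg_pred &, forall x y, bmul x y \in subalg_pred}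
}.

Section SubalgebraType.
Context {K : numFieldType} {A : banachAlgType K}.
Variable D : subalgebra A.

HB.instance Definition _ :=
  GRing.isSubmodClosed.Build K A (subalg_pred D) (subalg_submod D).

Record subalg_of := SubalgElt {
  subalg_val :> A ;
  subalg_valP : subalg_val \in subalg_pred D
}.

HB.instance Definition _ := [isSub for subalg_val].
HB.instance Definition _ := [Choice of subalg_of by <:].
HB.instance Definition _ := [SubChoice_isSubLmodule of subalg_of by <:].

Definition subalg_mul (a b : subalg_of) : subalg_of :=
  SubalgElt (subalg_mulr (subalg_valP a) (subalg_valP b)).

End SubalgebraType.

Section SigmaDerivation.
Context {K : numFieldType} {A : banachAlgType K} {D : subalgebra A}.
Implicit Types f s d : subalg_of D -> A.

Definition sigma_derivation s d :=
  forall a b, d (subalg_mul a b) = bmul (d a) (s b) + bmul (s a) (d b).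

(* Maps D -> A are composed as partial maps on A with domain D: the value of
   a composition is None as soon as an intermediate result leaves D. *)
Definition after f (g : A -> option A) : A -> option A :=
  fun x => obind (fun y => omap f (insub y)) (g x).

Definition power f (n : nat) : A -> option A := iter n (after f) Some.

Definition digit (k i : nat) : bool := odd (k %/ 2 ^ i).

(* With k = (c_n ... c_1)_2, leading zeros included, c_i is [digit k i.-1];
   the map for c_1 is applied first, 1 stands for d and 0 for s. *)
Fixpoint phi s d (n k : nat) : A -> option A :=
  if n is m.+1 then after (if digit k m then d else s) (phi s d m k) else Some.

Lemma phi_5_11 s d :
  phi s d 5 11 = after s (after d (after s (after d (after d Some)))).
Proof. by []. Qed.

Lemma phi_total s d (n k : nat) (a : subalg_of D) :
  (forall x, s x \in subalg_pred D) -> (forall x, d x \in subalg_pred D) ->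
  exists y : subalg_of D, phi s d n k (val a) = Some (val y).
Proof.
move=> sD dD; elim: n => [|n [y IHn]]; first by exists a.
rewrite /= /after IHn /= valK /=.
case: (digit k n); first by exists (SubalgElt (dD y)).
by exists (SubalgElt (sD y)).
Qed.

End SigmaDerivation.

(* Main.v *)
(* By induction on n. For k < 2^n, phi_{n+1,k} = s phi_{n,k} and
   phi_{n+1,2^n+k} = d phi_{n,k}. Applying d to the formula for n, the
   derivation rule turns each term into two: those with d on the left factor
   are the upper half of the sum for n+1, those with s on the left the lower
   half. *)
Require Import Defs.
From HB Require Import structures.
From mathcomp Require Import all_boot all_order all_algebra.
From mathcomp Require Import all_classical all_reals all_analysis.

Set Implicit Arguments.
Unset Strict Implicit.
Unset Printing Implicit Defensive.

Import GRing.Theory numFieldNormedType.Exports.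
Local Open Scope ring_scope.

Lemma digit_small n k : (k < 2 ^ n)%N -> digit k n = false.
Proof. by move=> kn; rewrite /digit divn_small. Qed.

Lemma digit_high n k : (k < 2 ^ n)%N -> digit (2 ^ n + k) n.
Proof.
by move=> kn; rewrite /digit divnDl ?dvdnn // divnn expn_gt0 divn_small.
Qed.

(** Dividing by [2 ^ m] turns the added [2 ^ n] into [2 ^ (n - m)], which is even because [m < n],
    so the parity is unchanged. *)
Lemma digit_low n k m : (m < n)%N -> digit (2 ^ n + k) m = digit k m.
Proof.
move=> mn; rewrite /digit divnDl ?dvdn_exp2l 1?ltnW // -expnB // 1?ltnW //.
by rewrite oddD oddX orbF subn_eq0 leqNgt mn.
Qed.

Section CompositionOfPartialMaps.
Context {K : numFieldType} {A : banachAlgType K} {D : subalgebra A}.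
Implicit Types s d f : subalg_of D -> A.

Lemma phi_low s d n k m : (m <= n)%N -> phi s d m (2 ^ n + k) = phi s d m k.
Proof. by elim: m => //= m IHm mn; rewrite IHm 1?ltnW // digit_low. Qed.

Lemma phiS_low s d n k : (k < 2 ^ n)%N ->
  phi s d n.+1 k = after s (phi s d n k).
Proof. by move=> kn; rewrite /= digit_small. Qed.

Lemma phiS_high s d n k : (k < 2 ^ n)%N ->
  phi s d n.+1 (2 ^ n + k) = after d (phi s d n k).
Proof. by move=> kn; rewrite /= digit_high // phi_low. Qed.

Lemma after_val f (g : A -> option A) x (z : subalg_of D) :
  g x = Some (val z) -> after f g x = Some (f z).
Proof. by rewrite /after => -> /=; rewrite valK. Qed.

(** Definedness of a composite is the only source of membership in [D] for intermediate values,
    since [s] and [d] need not map into [D]. *)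
Lemma after_SomeP f (g : A -> option A) x y :
  after f g x = Some y -> exists z : subalg_of D, g x = Some (val z).
Proof.
rewrite /after; case: (g x) => //= w.
by case: insubP => //= z _ <- _; exists z.
Qed.

(** Brings the values at level [n] back into [D], so that the induction hypothesis and the
    derivation rule apply to them. *)
Lemma phiS_factor s d n x (u : nat -> A) :
  (forall k, (k < 2 ^ n.+1)%N -> phi s d n.+1 k x = Some (u k)) ->
  exists U : nat -> subalg_of D, forall k, (k < 2 ^ n)%N ->
    [/\ phi s d n k x = Some (val (U k)), u k = s (U k) &
        u (2 ^ n + k)%N = d (U k)].
Proof.
move=> hu.
suff /choice[U hU] : forall k, exists z : subalg_of D, (k < 2 ^ n)%N ->
    [/\ phi s d n k x = Some (val z), u k = s z & u (2 ^ n + k)%N = d z].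
  by exists U.
move=> k.
(* Choice needs a witness for every [k]; the value [0] outside the range is arbitrary. *)
have [kn|_] := boolP (k < 2 ^ n)%N; last by exists 0.
have kS : (k < 2 ^ n.+1)%N by rewrite (leq_trans kn) ?leq_exp2l.
have kS' : (2 ^ n + k < 2 ^ n.+1)%N by rewrite expnS mul2n -addnn ltn_add2l.
have [z hz] : exists z : subalg_of D, phi s d n k x = Some (val z).
  by apply: (@after_SomeP s _ _ (u k)); rewrite -phiS_low // hu.
exists z => _; split=> //; apply: Some_inj.
  by rewrite -hu // phiS_low // (after_val _ hz).
by rewrite -hu // phiS_high // (after_val _ hz).
Qed.

End CompositionOfPartialMaps.

Theorem theorem3p2 (K : numFieldType) (A : banachAlgType K) (D : subalgebra A)
    (s d : {linear subalg_of D -> A}) (hd : sigma_derivation s d)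
    (n : nat) (a b : subalg_of D) (u v : nat -> A)
    (hu : forall k, (k < 2 ^ n)%N -> phi s d n k (val a) = Some (u k))
    (hv : forall k, (k < 2 ^ n)%N -> phi s d n k (val b) = Some (v k)) :
  power d n (val (subalg_mul a b)) =
    Some (\sum_(0 <= k < 2 ^ n) bmul (u k) (v (2 ^ n - 1 - k)%N)).
Proof.
elim: n u v hu hv => [|n IHn] u v hu hv.
  rewrite expn0 big_nat1 -(Some_inj (hu 0%N isT)).
  by rewrite -(Some_inj (hv 0%N isT)).
have [U hU] := phiS_factor hu; have [V hV] := phiS_factor hv.
have rev k : (k < 2 ^ n)%N -> (2 ^ n - 1 - k < 2 ^ n)%N.
  by move=> kn; rewrite -subnDA add1n ltn_subrL expn_gt0.
(* The sum for [n] is formed inside [D], which is closed under sums and products; hence [d] may be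
   applied to it once more. *)
pose w := \sum_(0 <= k < 2 ^ n) subalg_mul (U k) (V (2 ^ n - 1 - k)%N).
have hw : power d n (val (subalg_mul a b)) = Some (val w).
  rewrite (IHn (fun k => val (U k)) (fun k => val (V k))).
  - by rewrite /w raddf_sum.
  - by move=> k /hU [].
  - by move=> k /hV [].
rewrite /power iterS (after_val _ hw) /w raddf_sum; congr Some.
(* [addrC] puts the terms with [s] on the left factor first, matching the lower half of the
   indices. *)
rewrite (eq_bigr _ (fun k _ => hd _ _)) big_split /= addrC.
rewrite [in RHS](@big_cat_nat _ _ _ (2 ^ n)) //=; last by rewrite leq_exp2l.
have -> : (2 ^ n.+1 = 2 ^ n + 2 ^ n)%N by rewrite expnS mul2n addnn.
congr (_ + _).
  apply: eq_big_nat => k /andP[_ kn].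
  (* Complementing all [n.+1] digits turns the leading 0 of [k] into 1, so the right factor gets
     [d]. *)
  have -> : (2 ^ n + 2 ^ n - 1 - k = 2 ^ n + (2 ^ n - 1 - k))%N.
    by rewrite -!subnDA add1n addnBA.
  by have [_ -> _] := hU _ kn; have [_ _ ->] := hV _ (rev _ kn).
rewrite -{3}[(2 ^ n)%N]add0n big_addn addnK.
apply: eq_big_nat => k /andP[_ kn].
(* Here the leading digit 1 becomes 0, so the right factor gets [s]. *)
have -> : (2 ^ n + 2 ^ n - 1 - (k + 2 ^ n) = 2 ^ n - 1 - k)%N.
  by rewrite -!subnDA addnCA addnA subnDr addnC.
by rewrite addnC; have [_ _ ->] := hU _ kn; have [_ -> _] := hV _ (rev _ kn).
Qed.
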